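(* Let $p>3$ be a prime, and let $(a_k)_{k\ge 0}$ and $(b_k)_{k\ge 0}$ be any sequences of $p$-adic integers, with dual sequences $(a_k^* )_{k\ge0}$ and $(b_k^* )_{k\ge0}$. Then $$\sum_{k=0}^{(p-1)/2}\binom{2k}{k}^2\frac{a_k b_k}{16^k}\equiv\left(\frac{-1}{p}\right)\sum_{k=0}^{(p-1)/2}\sum_{i=0}^{(p-1)/2}\frac{\binom{2k}{k}^2\binom{2i}{i}^2}{\binom{i+k}{k}16^{k+i}}\,a_k^* b_i^*\pmod{p^2}.$$ Moreover, $$\sum_{k=0}^{(p-1)/2}\binom{2k}{k}^2\frac{a_{2k}}{16^k}\equiv\left(\frac{-1}{p}\right)\sum_{k=0}^{p-1}\frac{\mathcal{P}_k}{16^k}\,a_k^*\pmod{p^2}.$$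
   Context: The dual sequence of $(a_n)_{n\ge0}$ is $a_n^*:=\sum_{k=0}^n\binom{n}{k}(-1)^k a_k$. The symbol $\left(\frac{\cdot}{p}\right)$ is the Legendre symbol. The Catalan–Larcombe–French numbers are $\mathcal{P}_n=\sum_{k=0}^n \binom{2k}{k}^2\binom{2n-2k}{n-k}^2/\binom{n}{k}$ for $n\ge0$ (so $\mathcal P_0=1$, $\mathcal P_1=8$, $\mathcal P_2=80$). They satisfy $n^2\mathcal P_n=8(3n^2-3n+1)\mathcal P_{n-1}-128(n-1)^2\mathcal P_{n-2}$ for $n\ge2$. Congruences modulo $p^2$ are in the ring $\mathbb{Z}_p$ of $p$-adic integers. *)

(* Defs.v *)
From HB Require Import structures.
From mathcomp Require Import all_boot all_order all_algebra.
From mathcomp Require Import boolp classical_sets.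

Set Implicit Arguments.
Unset Strict Implicit.
Unset Printing Implicit Defensive.

Import GRing.Theory.
Local Open Scope ring_scope.

(* The ring Z_p of p-adic integers as the inverse limit of the rings Z/p^n:   *)
(* padic_res x n is the canonical representative, in [0, p^n), of the residue *)
(* of x modulo p^n. Coherence makes it reduced: intdiv's remainder is         *)
(* nonnegative and smaller than the (nonzero) modulus.                        *)
Record padic_int (p : nat) (p_pr : prime p) := PadicInt {
  padic_res :> nat -> int;
  padic_coh : forall n, (padic_res n.+1 %% (p ^ n)%N)%Z = padic_res n }.

Section PadicRing.
Variables (p : nat) (p_pr : prime p).
Local Notation Zp := (padic_int p_pr).
Implicit Types x y z : Zp.

Lemma padic_inj x y : (forall n, x n = y n) -> x = y.
Proof.
case: x y => [u cu] [v cv] /= uv; have {}uv : u = v by apply/funext.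
by case: _ / uv cv => cv; congr PadicInt; apply: Prop_irrelevance.
Qed.

Lemma padic_modS n (m : int) :
  ((m %% (p ^ n.+1)%N)%Z %% (p ^ n)%N)%Z = (m %% (p ^ n)%N)%Z.
Proof.
rewrite {2}(divz_eq m (p ^ n.+1)%N) {3}expnS PoszM mulrA.
by rewrite modzMDl.
Qed.

Lemma padic_resE x n : (x n %% (p ^ n)%N)%Z = x n.
Proof. by rewrite -padic_coh modz_mod. Qed.

Fact padic_mk_subproof (f : nat -> int)
    (f_coh : forall n, (f n.+1 = f n %[mod (p ^ n)%N])%Z) n :
  ((f n.+1 %% (p ^ n.+1)%N)%Z %% (p ^ n)%N)%Z = (f n %% (p ^ n)%N)%Z.
Proof. by rewrite padic_modS. Qed.
Definition padic_mk (f : nat -> int)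
    (f_coh : forall n, (f n.+1 = f n %[mod (p ^ n)%N])%Z) : Zp :=
  PadicInt p_pr (padic_mk_subproof f_coh).

Fact padic_of_int_subproof (m : int) n : (m = m %[mod (p ^ n)%N])%Z.
Proof. by []. Qed.
Definition padic_of_int m : Zp := padic_mk (padic_of_int_subproof m).

Fact padic_opp_subproof x n : (- x n.+1 = - x n %[mod (p ^ n)%N])%Z.
Proof. by rewrite -(padic_coh x n) modzNm. Qed.
Definition padic_opp x : Zp := padic_mk (padic_opp_subproof x).

Fact padic_add_subproof x y n :
  (x n.+1 + y n.+1 = x n + y n %[mod (p ^ n)%N])%Z.
Proof. by rewrite -(padic_coh x n) -(padic_coh y n) modzDm. Qed.
Definition padic_add x y : Zp := padic_mk (padic_add_subproof x y).

Fact padic_mul_subproof x y n :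
  (x n.+1 * y n.+1 = x n * y n %[mod (p ^ n)%N])%Z.
Proof. by rewrite -(padic_coh x n) -(padic_coh y n) modzMm. Qed.
Definition padic_mul x y : Zp := padic_mk (padic_mul_subproof x y).

HB.instance Definition _ := gen_eqMixin Zp.
HB.instance Definition _ := gen_choiceMixin Zp.

Fact padic_addA : associative padic_add.
Proof.
by move=> x y z; apply: padic_inj => n /=;
  rewrite modzDml modzDmr addrA.
Qed.
Fact padic_addC : commutative padic_add.
Proof. by move=> x y; apply: padic_inj => n /=; rewrite addrC. Qed.
Fact padic_add0 : left_id (padic_of_int 0) padic_add.
Proof.
by move=> x; apply: padic_inj => n /=;
  rewrite modzDml add0r padic_resE.
Qed.
Fact padic_addN : left_inverse (padic_of_int 0) padic_opp padic_add.
Proof. by move=> x; apply: padic_inj => n /=; rewrite modzDml addNr. Qed.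

HB.instance Definition _ :=
  GRing.isZmodule.Build Zp padic_addA padic_addC padic_add0 padic_addN.

Fact padic_mulA : associative padic_mul.
Proof.
by move=> x y z; apply: padic_inj => n /=;
  rewrite modzMml modzMmr mulrA.
Qed.
Fact padic_mulC : commutative padic_mul.
Proof. by move=> x y; apply: padic_inj => n /=; rewrite mulrC. Qed.
Fact padic_mul1 : left_id (padic_of_int 1) padic_mul.
Proof.
by move=> x; apply: padic_inj => n /=;
  rewrite modzMml mul1r padic_resE.
Qed.
Fact padic_mulDl : left_distributive padic_mul padic_add.
Proof.
by move=> x y z; apply: padic_inj => n /=; rewrite modzMml modzDm mulrDl.
Qed.
Fact padic_1neq0 : padic_of_int 1 != 0 :> Zp.
Proof.
apply/eqP => /(congr1 (fun x : Zp => x 1%N)) /= /eqP.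
by rewrite !modz_nat expn1 mod0n modn_small // prime_gt1.
Qed.

HB.instance Definition _ := GRing.Zmodule_isComNzRing.Build Zp
  padic_mulA padic_mulC padic_mul1 padic_mulDl padic_1neq0.

Definition padic_unit : {pred Zp} := fun x => `[< exists y, y * x = 1 >].
Definition padic_inv x : Zp := xget x [set y | y * x = 1].

Fact padic_mulV : {in padic_unit, left_inverse 1 padic_inv *%R}.
Proof. by move=> x /asboolP /(xgetPex x). Qed.
Fact padic_unitPl x y : y * x = 1 -> x \in padic_unit.
Proof. by move=> yx1; apply/asboolP; exists y. Qed.
Fact padic_inv_out : {in [predC padic_unit], padic_inv =1 id}.
Proof.
move=> x /asboolPn xNU; rewrite /padic_inv; case: xgetP => // y _ yx1.
by case: xNU; exists y.
Qed.

HB.instance Definition _ :=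
  GRing.ComNzRing_hasMulInverse.Build Zp padic_mulV padic_unitPl padic_inv_out.

Lemma padic_natrE m : m%:R = padic_of_int m :> Zp.
Proof.
elim: m => [|m IHm]; first by [].
rewrite mulrS IHm; apply: padic_inj => n /=.
by rewrite modzDm -PoszD add1n.
Qed.

(* So dividing by an integer prime to p is genuine division in Z_p, and ratr  *)
(* sends a rational with denominator prime to p to its value in Z_p.          *)
Lemma padic_natr_unit m : coprime m p -> (m%:R : Zp) \is a GRing.unit.
Proof.
move=> co_mp; pose u n : int := (egcdz m (p ^ n)%N).1.
have uP n : (u n * m = 1 %[mod (p ^ n)%N])%Z.
  rewrite /u; case: egcdzP => s t Dst _ /=.
  have: coprime m (p ^ n) by rewrite coprimeXr.
  rewrite /coprime => /eqP co1; move: Dst; rewrite /gcdz !absz_nat co1 => Dst.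
  by rewrite -[1]/(1%N : int) -Dst addrC modzMDl.
have u_coh n : (u n.+1 = u n %[mod (p ^ n)%N])%Z.
  have uSP : (u n.+1 * m = 1 %[mod (p ^ n)%N])%Z.
    by rewrite -padic_modS uP padic_modS.
  rewrite -[u n.+1]mulr1 -modzMmr -(uP n) modzMmr mulrCA -modzMmr uSP.
  by rewrite modzMmr mulr1.
apply: (padic_unitPl (y := padic_mk u_coh)); rewrite padic_natrE.
by apply: padic_inj => n /=; rewrite modzMm uP.
Qed.

End PadicRing.

Definition congr_mod (R : comPzRingType) (m x y : R) : Prop :=
  exists z : R, x - y = m * z.

Definition dual_seq (R : pzRingType) (a : nat -> R) (n : nat) : R :=
  \sum_(0 <= k < n.+1) 'C(n, k)%:R * (-1) ^+ k * a k.

(* Only meaningful for p prime, when 'F_p is Z/p. *)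
Definition legendre (a : int) (p : nat) : int :=
  if a%:~R == 0 :> 'F_p then 0
  else if [exists x : 'F_p, x ^+ 2 == a%:~R] then 1 else -1.

Definition catalan_larcombe_french (n : nat) : rat :=
  \sum_(0 <= k < n.+1)
    ('C(2 * k, k) ^ 2 * 'C(2 * n - 2 * k, n - k) ^ 2)%:R / 'C(n, k)%:R.

(* Main.v *)
Require Import Defs.
From mathcomp Require Import all_boot all_order all_algebra finfield.
From mathcomp Require Import zify ring.

Import GRing.Theory.
Local Open Scope ring_scope.

(**
Put n = (p - 1) / 2. The weights of both sums are, modulo p^2, up to sign the
numbers 'C(n, k) * 'C(n + k, k): since 2n = p - 1,
  4 (n - j) (n + j + 1) = (p - (2j + 1)) (p + (2j + 1)) = p^2 - (2j + 1)^2,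
and multiplying over j < k turns the factorials of 'C(n, k) * 'C(n + k, k) into
the odd numbers that make up 'C(2k, k)^2, with an error divisible by p^2
([central_bin_sqr_congr]). So 'C(2k, k)^2 / 16^k can be replaced by
s k = (-1)^k 'C(n, k) 'C(n + k, k) for every k < p.

Since taking the dual sequence is an involution ([dual_seqK]), a_k and b_k
expand in the dual sequences with binomial coefficients 'C(k, i) and 'C(k, j).
The first sum becomes a bilinear form in the dual sequences whose coefficients
are the moments
  M(i, j) = sum_k s k 'C(k, i) 'C(k, j).
These have a closed form ([shifted_legendre_bin_bin]): as a sum over k, M(i, j)
is an iterated finite difference of a binomial coefficient, and
  'C(i + j, i) M(i, j) = (-1)^n |s i| |s j|.
The identity is exact. Reading the right-hand side modulo p^2 with the first
congruence gives the coefficient of the theorem ([moment_congr]); the binomial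
'C(i + j, i) is invertible because i + j < p. The sign (-1)^n is the Legendre
symbol of -1 ([legendre_opp1]).

For the second sum, a_(2k) expands with coefficients 'C(2k, m), which by
Vandermonde's convolution equal the sum over i + j = m of 'C(k, i) 'C(k, j).
The coefficient of the m-th dual term is then the sum of the M(i, m - i), and
the closed form turns this term by term into the definition of the m-th
Catalan-Larcombe-French number divided by 16^m.
*)

(** * Alternating binomial sums *)

(** Both sides are the multinomial coefficient (i + a + b)! / (i! a! b!). *)
Lemma mul_bin_bin (i a b : nat) :
  ('C(i + a + b, i + a) * 'C(i + a, i) = 'C(i + a + b, i) * 'C(a + b, a))%N.
Proof.
have fact3_gt0 : (0 < i`! * a`! * b`!)%N by rewrite !muln_gt0 !fact_gt0.
apply/eqP; rewrite -(eqn_pmul2r fact3_gt0); apply/eqP.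
have Eia := bin_fact (leq_addr a i); have Eab := bin_fact (leq_addr b a).
have Eiab := bin_fact (leq_addr b (i + a)).
have Eiab' := bin_fact (leq_addr (a + b) i).
rewrite !addKn in Eia Eab Eiab; rewrite addKn addnA in Eiab'.
transitivity ((i + a + b)`!).
  by rewrite -Eiab -Eia; ring.
by rewrite -Eiab' -Eab; ring.
Qed.

(** Pascal's rule: the difference of order N + 1 of f is, up to sign, the
difference of order N of its first difference. *)
Lemma alternating_bin_sumS (R : comNzRingType) (f : nat -> R) (N : nat) :
  \sum_(0 <= l < N.+2) (-1) ^+ l * 'C(N.+1, l)%:R * f l
  = \sum_(0 <= l < N.+1) (-1) ^+ l * 'C(N, l)%:R * (f l - f l.+1).
Proof.
rewrite big_nat_recl // bin0.
under eq_bigr do rewrite binS natrD mulrDr mulrDl.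
rewrite big_split /= big_nat_recr //= bin_small // mulr0 mul0r addr0.
under [RHS]eq_bigr do rewrite mulrBr.
rewrite [RHS]big_split /= [in RHS]big_nat_recl // bin0 addrA; congr (_ + _).
by apply: eq_bigr => l _; rewrite exprS; ring.
Qed.

(** Each difference operator lowers the bottom index of x |-> 'C(x, r) by one,
so N of them leave 'C(x, r - N), or 0 once the degree r is exhausted. *)
Lemma alternating_bin_sum (R : comNzRingType) (N x r : nat) :
  \sum_(0 <= l < N.+1) (-1) ^+ l * 'C(N, l)%:R * 'C(x + l, r)%:R
  = (if (N <= r)%N then (-1) ^+ N * 'C(x, r - N)%:R else 0) :> R.
Proof.
elim: N r => [|N IHN] r.
  by rewrite big_nat1 addn0 subn0 bin0 mulr1.
rewrite (alternating_bin_sumS _ (fun l => 'C(x + l, r)%:R)).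
case: r => [|r].
  by rewrite big1 // => l _; rewrite !bin0 subrr mulr0.
rewrite ltnS subSS (eq_bigr (fun l =>
  - ((-1) ^+ l * 'C(N, l)%:R * 'C(x + l, r)%:R))); last first.
  by move=> l _; rewrite addnS binS natrD; ring.
rewrite sumrN IHN; case: ifP => _; last by rewrite oppr0.
by rewrite exprS; ring.
Qed.

(** * Dual sequences *)

(** A range of summation that does not depend on n lets the sums over n and k
be exchanged. *)
Lemma dual_seq_widen (R : comNzRingType) (a : nat -> R) (n N : nat) :
  (n < N)%N ->
  \sum_(0 <= k < N) 'C(n, k)%:R * (-1) ^+ k * a k = dual_seq a n.
Proof.
move=> ltnN; rewrite (big_cat_nat_idem (addr0 0) (n := n.+1)) //=.
rewrite [X in _ + X]big_nat [X in _ + X]big1 ?addr0 // => k /andP[ltnk _].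
by rewrite bin_small // !mul0r.
Qed.

(** The coefficient of a_i in the double dual is an alternating sum of
'C(n, k) * 'C(k, i) over k, that is, an n-th difference of a polynomial of
degree i, which vanishes for i < n. *)
Lemma dual_seqK (R : comNzRingType) (a : nat -> R) (n : nat) :
  dual_seq (dual_seq a) n = a n.
Proof.
have E k : (k < n.+1)%N -> dual_seq a k =
    \sum_(0 <= i < n.+1) 'C(k, i)%:R * (-1) ^+ i * a i.
  by move=> lekn; rewrite dual_seq_widen.
rewrite /dual_seq (eq_big_nat _ _ (F2 := fun k => \sum_(0 <= i < n.+1)
   (-1) ^+ k * 'C(n, k)%:R * 'C(0 + k, i)%:R * ((-1) ^+ i * a i))); last first.
  move=> k /andP[_ lekn]; rewrite -/(dual_seq a k) E // big_distrr /=.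
  by apply: eq_bigr => i _; rewrite add0n; ring.
rewrite exchange_big_nat /= big_nat_recr //= big_nat big1 => [|i /andP[_ ltin]].
  rewrite add0r -big_distrl /= alternating_bin_sum leqnn subnn bin0 mulr1.
  by rewrite mulrA -exprD addnn -signr_odd odd_double mul1r.
by rewrite -big_distrl /= alternating_bin_sum leqNgt ltin mul0r.
Qed.

(** * Moments of the shifted Legendre coefficients *)

(** The coefficient of x^k in the shifted Legendre polynomial P_n(1 - 2x). *)
Definition shifted_legendre_coef (R : pzRingType) (n k : nat) : R :=
  (-1) ^+ k * 'C(n, k)%:R * 'C(n + k, k)%:R.

(** The factors (-1) ^+ i and (-1) ^+ j only cancel the signs of the
coefficients. For i, j <= n, put k = i + l: the product of the four binomials
in the k-th term is a constant times 'C(n - i, l) * 'C(n + i + l, n + j), so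
the sum is a difference of order n - i of a binomial coefficient. *)
Lemma shifted_legendre_bin_bin (R : comNzRingType) (n i j : nat) :
  'C(i + j, i)%:R *
    \sum_(0 <= k < n.+1)
       shifted_legendre_coef R n k * ('C(k, i)%:R * 'C(k, j)%:R)
  = (-1) ^+ n * ((-1) ^+ i * shifted_legendre_coef R n i)
              * ((-1) ^+ j * shifted_legendre_coef R n j).
Proof.
rewrite /shifted_legendre_coef -!mulrA !signrMK.
have [ltni|lein] := ltnP n i.
  rewrite ['C(n, i)]bin_small // !(mulr0, mul0r) big_nat big1 ?mulr0 // => k /andP[_ lekn].
  by rewrite ['C(k, i)]bin_small ?(leq_ltn_trans _ ltni) // !(mulr0, mul0r).
have [ltnj|lejn] := ltnP n j.
  rewrite ['C(n, j)]bin_small // !(mulr0, mul0r) big_nat big1 ?mulr0 // => k.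
  move=> /andP[_ lekn].
  by rewrite ['C(k, j)]bin_small ?(leq_ltn_trans _ ltnj) // !(mulr0, mul0r).
pose N := (n - i)%N; have defn : n = (i + N)%N by rewrite subnKC.
rewrite (big_cat_nat_idem (addr0 0) (n := i)) //=; last by rewrite ltnW.
rewrite [X in X + _]big_nat [X in X + _]big1 ?add0r; last first.
  by move=> k /andP[_ ltki]; rewrite ['C(k, i)]bin_small // !(mulr0, mul0r).
rewrite -[X in \sum_(X <= _ < _) _]add0n big_addn subSn // -/N.
rewrite (eq_big_nat _ _ (F2 := fun l =>
  (-1) ^+ i * 'C(n, i)%:R * 'C(n + j, j)%:R *
    ((-1) ^+ l * 'C(N, l)%:R * 'C(n + i + l, n + j)%:R))); last first.
  move=> l; rewrite ltnS /= => lelN.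
  (* These two trinomial revisions make k = l + i occur only in
     'C(N, l) and in 'C(n + i + l, n + j). *)
  have E1 : ('C(n, l + i) * 'C(l + i, i) = 'C(n, i) * 'C(N, l))%N.
    have := mul_bin_bin i l (N - l).
    by rewrite -!addnA subnKC // -defn addnC [(l + i)%N]addnC.
  have E2 : ('C(n + (l + i), l + i) * 'C(l + i, j) =
             'C(n + j, j) * 'C(n + i + l, n + j))%N.
    have [ltlij|lejli] := ltnP (l + i) j.
      rewrite ['C(l + i, j)]bin_small // ['C(n + i + l, _)]bin_small ?muln0 //.
      by rewrite -addnA [(i + l)%N]addnC ltn_add2l.
    have [r Dli] : exists r, (l + i = j + r)%N.
      by exists (l + i - j)%N; rewrite subnKC.
    rewrite -addnA [(i + l)%N]addnC Dli [(n + j)%N]addnC [RHS]mulnC.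
    rewrite [(n + (j + r))%N]addnC mul_bin_bin addnAC mul_bin_bin [(r + n)%N]addnC.
    by rewrite -['C(n + r, n)]bin_sub ?leq_addr // addKn.
  rewrite exprD.
  transitivity ((-1) ^+ i * (-1) ^+ l * ('C(n, l + i) * 'C(l + i, i))%:R *
    ('C(n + (l + i), l + i) * 'C(l + i, j))%:R : R); first by ring.
  by rewrite E1 E2; ring.
rewrite -big_distrr /= alternating_bin_sum.
have -> : (N <= n + j)%N by rewrite /N; lia.
have -> : (n + j - N = i + j)%N by rewrite /N; lia.
have E : ('C(n + i, i + j) * 'C(i + j, i) = 'C(n + i, i) * 'C(n, j))%N.
  by have := mul_bin_bin i j (n - j); rewrite -addnA subnKC // [(i + n)%N]addnC.
transitivity ((-1) ^+ (i + N) * 'C(n, i)%:R * 'C(n + j, j)%:R *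
  ('C(n + i, i + j) * 'C(i + j, i))%:R : R); first by rewrite exprD; ring.
by rewrite E -defn; ring.
Qed.

(** * Congruences *)

Section Congruence.
Variables (R : comPzRingType) (m : R).

Lemma congr_mod_refl x : congr_mod m x x.
Proof. by exists 0; rewrite subrr mulr0. Qed.

Lemma congr_mod_sym x y : congr_mod m x y -> congr_mod m y x.
Proof. by case=> z Dz; exists (- z); rewrite mulrN -Dz opprB. Qed.

Lemma congr_mod_trans x y z :
  congr_mod m x y -> congr_mod m y z -> congr_mod m x z.
Proof.
move=> [u Du] [v Dv]; exists (u + v).
by rewrite mulrDr -Du -Dv addrA subrK.
Qed.

Lemma congr_modM x y u v :
  congr_mod m x y -> congr_mod m u v -> congr_mod m (x * u) (y * v).
Proof.
move=> [s Ds] [t Dt]; exists (s * u + y * t).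
rewrite mulrDr mulrA -Ds [m * _]mulrCA -Dt; ring.
Qed.

Lemma congr_mod_sum (N : nat) (f g : nat -> R) :
  (forall k, (k < N)%N -> congr_mod m (f k) (g k)) ->
  congr_mod m (\sum_(0 <= k < N) f k) (\sum_(0 <= k < N) g k).
Proof.
elim: N => [|N IHN] fg; first by rewrite !big_geq //; apply: congr_mod_refl.
rewrite !big_nat_recr //=.
have [s Ds] := IHN (fun k ltkN => fg k (ltnW ltkN)).
by have [t Dt] := fg N (ltnSn N); exists (s + t); rewrite mulrDr -Ds -Dt; ring.
Qed.

End Congruence.

(** * Central binomial coefficients modulo the square of 2n + 1 *)

Lemma mul_central_bin (k : nat) :
  (k.+1 * 'C(2 * k.+1, k.+1) = 2 * (2 * k + 1) * 'C(2 * k, k))%N.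
Proof.
have E1 := mul_bin_diag (2 * k).+2 k; have E2 := mul_bin_diag (2 * k).+1 k.
have E3 : 'C((2 * k).+1, k) = 'C((2 * k).+1, k.+1).
  by rewrite -bin_sub; [congr 'C(_, _); lia | lia].
rewrite /= E3 in E1 E2.
have -> : (2 * k.+1 = (2 * k).+2)%N by lia.
rewrite -E1 -mulnA addn1 E2; ring.
Qed.

(** By induction on k: multiplied by (k + 1)^2, the left side grows by the factor
4 (2k + 1)^2 and the right side by -16 (n - k) (n + k + 1), which is
4 ((2k + 1)^2 - (2n + 1)^2). For k > n the right side is 0, and the statement
says that the square of 'C(2k, k) is a multiple of (2n + 1)^2. *)
Lemma central_bin_sqr_congr (R : comUnitRingType) (n k : nat) :
  (forall j, (0 < j <= k)%N -> (j%:R : R) \is a GRing.unit) ->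
  congr_mod ((2 * n + 1)%:R ^+ 2 : R)
    ('C(2 * k, k)%:R ^+ 2) (16%:R ^+ k * shifted_legendre_coef R n k).
Proof.
rewrite /shifted_legendre_coef; elim: k => [|k IHk] Uk.
  by rewrite !bin0 !mulr1 expr1n; apply: congr_mod_refl.
have [|z Dz] := IHk; first by move=> j /andP[j0 lejk]; rewrite Uk // j0 ltnW.
have Uk1 : (k.+1%:R : R) \is a GRing.unit by rewrite Uk ?leqnn.
set P : R := _%:R ^+ 2 in Dz *.
have E1 : k.+1%:R * 'C(2 * k.+1, k.+1)%:R
    = 2%:R * (2 * k + 1)%:R * 'C(2 * k, k)%:R :> R.
  by rewrite -!natrM mul_central_bin.
have E2 : k.+1%:R * 'C(n, k.+1)%:R = (n%:R - k%:R) * 'C(n, k)%:R :> R.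
  rewrite -natrM mul_bin_left natrM; have [lekn|ltnk] := leqP k n.
    by rewrite natrB.
  by rewrite bin_small // !mulr0.
have E3 : k.+1%:R * 'C(n + k.+1, k.+1)%:R
    = (n%:R + k%:R + 1) * 'C(n + k, k)%:R :> R.
  by rewrite -natrM addnS -mul_bin_diag /= natrM -addn1 !natrD.
set c := 'C(2 * k.+1, k.+1)%:R in E1 *; set u := 'C(n, k.+1)%:R in E2 *.
set v := 'C(n + k.+1, k.+1)%:R in E3 *; set x := k.+1%:R in E1 E2 E3 Uk1.
set w := (16%:R ^+ k * _) in Dz.
have E : x ^+ 2 * (c ^+ 2 - 16%:R ^+ k.+1 * ((-1) ^+ k.+1 * u * v))
   = P * (4%:R * (2 * k + 1)%:R ^+ 2 * z + 4%:R * w).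
  transitivity ((x * c) ^+ 2 - 16%:R ^+ k.+1 * ((-1) ^+ k.+1 * (x * u) * (x * v))).
    by ring.
  rewrite E1 E2 E3 mulrDr [P * (_ * z)]mulrCA -Dz /P /w !exprS.
  by ring.
exists ((x ^+ 2)^-1 * (4%:R * (2 * k + 1)%:R ^+ 2 * z + 4%:R * w)).
by rewrite [RHS]mulrCA -E mulKr // unitrX.
Qed.

(** * Weighted sums in terms of dual sequences *)

Lemma weighted_sum_prod (R : comNzRingType) (n : nat) (w a b : nat -> R) :
  \sum_(0 <= k < n.+1) w k * (a k * b k)
  = \sum_(0 <= i < n.+1) \sum_(0 <= j < n.+1)
      (\sum_(0 <= k < n.+1) w k * ('C(k, i)%:R * 'C(k, j)%:R))
        * ((-1) ^+ (i + j) * (dual_seq a i * dual_seq b j)).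
Proof.
have E (c : nat -> R) k : (k < n.+1)%N -> c k =
    \sum_(0 <= i < n.+1) 'C(k, i)%:R * (-1) ^+ i * dual_seq c i.
  by move=> ltkn; rewrite -{1}[c k]dual_seqK dual_seq_widen.
rewrite (eq_big_nat _ _ (F2 := fun k => \sum_(0 <= i < n.+1)
    \sum_(0 <= j < n.+1) w k * ('C(k, i)%:R * 'C(k, j)%:R)
        * ((-1) ^+ (i + j) * (dual_seq a i * dual_seq b j)))); last first.
  move=> k /andP[_ ltkn]; rewrite (E a) // (E b) // big_distrl big_distrr /=.
  apply: eq_bigr => i _; rewrite mulrA big_distrr /=; apply: eq_bigr => j _.
  by rewrite exprD; ring.
rewrite exchange_big_nat /=; apply: eq_bigr => i _.
by rewrite exchange_big_nat /=; apply: eq_bigr => j _; rewrite [RHS]mulr_suml.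
Qed.

(** The coefficient 'C(2k, m) of the m-th dual term of a_(2k) is split by
Vandermonde's convolution, to express it by the same moments as in
[weighted_sum_prod]. *)
Lemma weighted_sum_double (R : comNzRingType) (n : nat) (w a : nat -> R) :
  \sum_(0 <= k < n.+1) w k * a (2 * k)%N
  = \sum_(0 <= m < 2 * n + 1)
      (\sum_(0 <= i < m.+1)
         \sum_(0 <= k < n.+1) w k * ('C(k, i)%:R * 'C(k, m - i)%:R))
        * ((-1) ^+ m * dual_seq a m).
Proof.
rewrite (eq_big_nat _ _ (F2 := fun k => \sum_(0 <= m < 2 * n + 1)
    (\sum_(0 <= i < m.+1) w k * ('C(k, i)%:R * 'C(k, m - i)%:R))
        * ((-1) ^+ m * dual_seq a m))); last first.
  move=> k /andP[_ ltkn]; rewrite -{1}[a _]dual_seqK.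
  rewrite -(@dual_seq_widen _ _ _ (2 * n + 1)); last by lia.
  rewrite big_distrr /=; apply: eq_bigr => m _.
  have -> : 'C(2 * k, m)%:R =
      \sum_(0 <= i < m.+1) 'C(k, i)%:R * 'C(k, m - i)%:R :> R.
    rewrite mul2n -addnn -binomial.Vandermonde natr_sum big_mkord.
    by apply: eq_bigr => i _; rewrite natrM.
  by rewrite -big_distrr /=; ring.
rewrite exchange_big_nat /=; apply: eq_bigr => m _.
by rewrite [in RHS]exchange_big_nat /= [RHS]mulr_suml.
Qed.

(** * The Legendre symbol of -1 *)

(** A root x of x^2 = -1 gives (-1)^n = x^(2n) = 1 by Fermat, so n is even.
Conversely X^n - 1 has at most n < p - 1 roots, so some nonzero y has
y^n != 1, hence y^n = -1 as its square is 1; for n even, y^(n/2) is a square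
root of -1. *)
Lemma legendre_opp1 (p : nat) :
  prime p -> odd p -> legendre (-1) p = (-1) ^+ ((p - 1) %/ 2).
Proof.
move=> p_pr p_odd; set n := ((p - 1) %/ 2)%N.
have Dp : p = (2 * n + 1)%N by rewrite /n; lia.
have p_gt1 := prime_gt1 p_pr.
have fermat (x : 'F_p) : x != 0 -> x ^+ (2 * n) = 1.
  move=> nz_x; apply: (mulfI nz_x); rewrite -exprS mulr1 -[RHS]expf_card.
  by rewrite card_Fp //; congr (x ^+ _); lia.
have opp1_neq1 : (-1 : 'F_p) != 1.
  rewrite eq_sym -subr_eq0 opprK -[1 + 1](natrD _ 1 1) -(dvdn_pcharf (pchar_Fp p_pr)).
  by apply/negP => /dvdn_leq; lia.
have sgn_n : ((-1 : 'F_p) ^+ n == 1) = ~~ odd n.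
  by rewrite -signr_odd; case: (odd n); rewrite ?eqxx // expr1 (negPf opp1_neq1).
rewrite /legendre mulrNz mulr1z oppr_eq0 oner_eq0.
have -> : [exists x : 'F_p, x ^+ 2 == -1] = ~~ odd n.
  apply/existsP/idP => [[x /eqP Dx]|even_n].
    rewrite -sgn_n -Dx -exprM fermat //; apply: contraNneq opp1_neq1 => x0.
    move: Dx; rewrite x0 expr0n /= => /(congr1 -%R)/eqP.
    by rewrite oppr0 opprK eq_sym oner_eq0.
  (* Otherwise all the p - 1 = 2n nonzero elements would be roots of X^n - 1. *)
  have [y nz_y] : exists2 y : 'F_p, y != 0 & y ^+ n != 1.
    apply/exists_inP; apply: contraT; rewrite negb_exists_in => /forall_inP all1.
    have n_gt0 : (0 < n)%N by lia.
    have := @max_unity_roots _ n (enum [pred y : 'F_p | y != 0]) n_gt0.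
    rewrite enum_uniq -cardE cardC1 card_Fp //.
    have -> : all n.-unity_root (enum [pred y : 'F_p | y != 0]).
      apply/allP => y; rewrite mem_enum => /all1.
      by rewrite negbK -unity_rootE.
    by move=> /(_ isT isT); lia.
  move=> yn_neq1; exists (y ^+ n./2).
  rewrite -exprM muln2 halfK (negPf even_n) subn0.
  have : (y ^+ n) ^+ 2 == 1 by rewrite -exprM mulnC fermat.
  by rewrite sqrf_eq1 (negPf yn_neq1).
by rewrite -signr_odd; case: (odd n).
Qed.

(** * Rational numbers with denominator prime to p *)

(** [ratr] is defined through the reduced fraction, and is not a morphism into
the p-adic integers. The reduced denominator divides d, so it is still
invertible and cross multiplication applies. *)
Lemma ratr_fracE (p : nat) (p_pr : prime p) (m d : nat) :
  coprime d p -> ratr (m%:R / d%:R) = m%:R / d%:R :> padic_int p_pr.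
Proof.
move=> co_dp; set x : rat := m%:R / d%:R.
have d_neq0 : (d%:R : rat) != 0.
  rewrite Num.Theory.pnatr_eq0; apply: contraTneq co_dp => ->.
  by rewrite /coprime gcd0n neq_ltn prime_gt1 // orbT.
have E : numq x * d%:Z = m%:Z * denq x.
  apply: (@intr_inj rat); rewrite !rmorphM /= numqE /x -!pmulrn mulrAC.
  by rewrite divfK.
have co_denq : coprime `|denq x| p.
  apply: coprime_dvdl co_dp; rewrite -(@Gauss_dvdr _ `|numq x|).
    by rewrite -[d]/(`|d%:Z|%N) -abszM E abszM dvdn_mull.
  by rewrite coprime_sym coprime_num_den.
have Ud := padic_natr_unit p_pr co_dp; have Uq := padic_natr_unit p_pr co_denq.
have Dq : (denq x)%:~R = `|denq x|%:R :> padic_int p_pr.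
  by rewrite -{1}absz_denq.
rewrite /ratr Dq; apply: (mulIr Uq); rewrite divrK //; apply: (mulIr Ud).
rewrite mulrAC divrK //; have := congr1 (fun z : int => z%:~R : padic_int p_pr) E.
by rewrite /= !rmorphM /= Dq.
Qed.

(** Both sums are brought to the same common fraction, to which [ratr_fracE]
applies; additivity of [ratr] would not do, as it fails for general
summands. *)
Lemma ratr_sum_frac (p : nat) (p_pr : prime p) (N : nat) (m d : nat -> nat) :
  (forall j, (j < N)%N -> coprime (d j) p) ->
  ratr (\sum_(0 <= j < N) (m j)%:R / (d j)%:R)
  = \sum_(0 <= j < N) (m j)%:R / (d j)%:R :> padic_int p_pr.
Proof.
move=> co_dp.
suff [M [D [coD DM DM']]] : exists M D : nat,
    [/\ coprime D p,
        \sum_(0 <= j < N) (m j)%:R / (d j)%:R = M%:R / D%:R :> rat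
      & \sum_(0 <= j < N) (m j)%:R / (d j)%:R = M%:R / D%:R :> padic_int p_pr].
  by rewrite DM DM' ratr_fracE.
elim: N co_dp => [|N IHN] co_dp.
  by exists 0%N, 1%N; rewrite coprime1n !big_geq // !mul0r.
have [j ltjN|M [D [coD DM DM']]] := IHN; first by rewrite co_dp // ltnW.
have cod := co_dp N (ltnSn N).
exists (M * d N + m N * D)%N, (D * d N)%N.
have addf (F : comUnitRingType) :
    (D%:R : F) \is a GRing.unit -> ((d N)%:R : F) \is a GRing.unit ->
    M%:R / D%:R + (m N)%:R / (d N)%:R
      = (M * d N + m N * D)%:R / (D * d N)%:R :> F.
  move=> UD Ud; rewrite natrD !natrM invrM // mulrDl; congr (_ + _).
    by rewrite mulrA mulrK.
  by rewrite [_^-1 * _]mulrC mulrA mulrK.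
have pos x : coprime x p -> (x%:R : rat) \is a GRing.unit.
  rewrite unitfE Num.Theory.pnatr_eq0; apply: contraTneq => ->.
  by rewrite /coprime gcd0n neq_ltn prime_gt1 // orbT.
rewrite coprimeMl coD cod !big_nat_recr //= DM DM' !addf ?pos //.
  exact: padic_natr_unit.
exact: padic_natr_unit.
Qed.

Lemma coprime_bin (p n k : nat) :
  prime p -> (k <= n)%N -> (n < p)%N -> coprime 'C(n, k) p.
Proof.
move=> p_pr lekn ltnp; rewrite coprime_sym prime_coprime //.
have : ~~ (p %| n`!)%N.
  elim: n ltnp {lekn} => [|n IHn] ltnp; first by rewrite dvdn1 neq_ltn prime_gt1 ?orbT.
  by rewrite factS Euclid_dvdM // negb_or IHn ?(ltnW ltnp) // gtnNdvd.
by apply: contra => pC; rewrite -(bin_fact lekn) dvdn_mulr.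
Qed.

(** * The congruences in the p-adic integers *)

Lemma padic_natr16_unit (p : nat) (p_pr : prime p) :
  odd p -> (16%:R : padic_int p_pr) \is a GRing.unit.
Proof.
by move=> p_odd; rewrite padic_natr_unit // (@coprimeXl 4 2 p) // coprime2n.
Qed.

Lemma central_bin_sqr_congr_padic (p : nat) (p_pr : prime p) (n k : nat) :
  p = (2 * n + 1)%N -> (k < p)%N ->
  congr_mod (p%:R ^+ 2 : padic_int p_pr) ('C(2 * k, k)%:R ^+ 2)
    (16%:R ^+ k * shifted_legendre_coef (padic_int p_pr) n k).
Proof.
move=> Dp ltkp; have -> : p%:R = (2 * n + 1)%:R :> padic_int p_pr.
  by rewrite -Dp.
apply: central_bin_sqr_congr => l /andP[l_gt0 lelk].
rewrite padic_natr_unit // coprime_sym prime_coprime // gtnNdvd //.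
exact: leq_ltn_trans lelk ltkp.
Qed.

(** Dividing the exact identity [shifted_legendre_bin_bin] by 'C(i + j, i), which
is prime to p, and replacing both coefficients by squares of central binomials.
When i or j exceeds n the moment is 0 and the congruence still holds. *)
Lemma moment_congr (p : nat) (p_pr : prime p) (n i j : nat) :
  p = (2 * n + 1)%N -> (i + j < p)%N ->
  congr_mod (p%:R ^+ 2)
    (\sum_(0 <= k < n.+1)
       shifted_legendre_coef (padic_int p_pr) n k
         * ('C(k, i)%:R * 'C(k, j)%:R))
    ((-1) ^+ n * (-1) ^+ (i + j) *
       ('C(2 * i, i)%:R ^+ 2 * 'C(2 * j, j)%:R ^+ 2
          / ('C(i + j, i)%:R * 16%:R ^+ (i + j)))).
Proof.
set Zp := padic_int p_pr => Dp ltijp; pose s := shifted_legendre_coef Zp n.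
have odd_p : odd p by rewrite Dp mul2n oddD odd_double.
have U16 := padic_natr16_unit p p_pr odd_p.
have UC : ('C(i + j, i)%:R : Zp) \is a GRing.unit.
  by rewrite padic_natr_unit // coprime_bin ?leq_addr.
have -> : \sum_(0 <= k < n.+1) s k * ('C(k, i)%:R * 'C(k, j)%:R)
    = (-1) ^+ n * (-1) ^+ (i + j) *
       (16%:R ^+ i * s i * (16%:R ^+ j * s j)
          / ('C(i + j, i)%:R * 16%:R ^+ (i + j))).
  apply: (mulrI UC); rewrite shifted_legendre_bin_bin -/s.
  rewrite invrM ?unitrX // !exprD.
  transitivity ((-1) ^+ n * ((-1) ^+ i * s i) * ((-1) ^+ j * s j)
    * ('C(i + j, i)%:R / 'C(i + j, i)%:R)
    * (16%:R ^+ i * 16%:R ^+ j / (16%:R ^+ i * 16%:R ^+ j))).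
    by rewrite !divrr ?unitrM ?unitrX // !mulr1.
  by ring.
apply: congr_modM; first exact: congr_mod_refl.
apply: congr_modM; last exact: congr_mod_refl.
by apply: congr_modM; apply: congr_mod_sym;
  apply: central_bin_sqr_congr_padic => //; lia.
Qed.

Theorem theorem1p2 (p : nat) (p_pr : prime p) (p_gt3 : (3 < p)%N)
    (a b : nat -> padic_int p_pr) :
  congr_mod (p%:R ^+ 2)
    (\sum_(0 <= k < ((p - 1) %/ 2).+1)
       'C(2 * k, k)%:R ^+ 2 * (a k * b k / 16%:R ^+ k))
    ((legendre (-1) p)%:~R *
       \sum_(0 <= k < ((p - 1) %/ 2).+1) \sum_(0 <= i < ((p - 1) %/ 2).+1)
         'C(2 * k, k)%:R ^+ 2 * 'C(2 * i, i)%:R ^+ 2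
           / ('C(i + k, k)%:R * 16%:R ^+ (k + i))
           * dual_seq a k * dual_seq b i)
  /\
  congr_mod (p%:R ^+ 2)
    (\sum_(0 <= k < ((p - 1) %/ 2).+1)
       'C(2 * k, k)%:R ^+ 2 * (a (2 * k)%N / 16%:R ^+ k))
    ((legendre (-1) p)%:~R *
       \sum_(0 <= k < p)
         ratr (catalan_larcombe_french k) / 16%:R ^+ k * dual_seq a k).
Proof.
set n := ((p - 1) %/ 2)%N; set Zp := padic_int p_pr in a b *.
have odd_p : odd p by case: (even_prime p_pr) p_gt3 => [->|].
have Dp : p = (2 * n + 1)%N by rewrite /n; lia.
have -> : (legendre (-1) p)%:~R = (-1) ^+ n :> Zp.
  by rewrite legendre_opp1 // -/n rmorphXn /= rmorphN1.
have U16 := padic_natr16_unit p p_pr odd_p.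
pose s := shifted_legendre_coef Zp n.
(* It is enough to prove both congruences with the Legendre coefficients as
   weights. *)
have weightE (c : nat -> Zp) : congr_mod (p%:R ^+ 2)
    (\sum_(0 <= k < n.+1) 'C(2 * k, k)%:R ^+ 2 * (c k / 16%:R ^+ k))
    (\sum_(0 <= k < n.+1) s k * c k).
  apply: congr_mod_sum => k ltkn.
  have -> : s k * c k = (16%:R ^+ k * s k) * (c k / 16%:R ^+ k).
    by rewrite [RHS]mulrCA [_ * s k / _]mulrAC divrr ?unitrX // mul1r mulrC.
  apply: congr_modM; last exact: congr_mod_refl.
  by apply: central_bin_sqr_congr_padic => //; lia.
have insert_signs (x : Zp) (l : nat) (u v : Zp) :
    (-1) ^+ n * (x * u * v) = (-1) ^+ n * (-1) ^+ l * x * ((-1) ^+ l * (u * v)).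
  by rewrite -!mulrA [x * ((-1) ^+ l * _)]mulrCA signrMK.
split.
  apply: congr_mod_trans (weightE (fun k => a k * b k)) _.
  rewrite weighted_sum_prod big_distrr /=; apply: congr_mod_sum => i ltin.
  rewrite big_distrr /=; apply: congr_mod_sum => j ltjn.
  have -> : 'C(j + i, i) = 'C(i + j, i) by rewrite addnC.
  rewrite (insert_signs _ (i + j)).
  apply: congr_modM; last exact: congr_mod_refl.
  by apply: moment_congr => //; lia.
apply: congr_mod_trans (weightE (fun k => a (2 * k)%N)) _.
rewrite weighted_sum_double -Dp big_distrr /=; apply: congr_mod_sum => m ltmp.
rewrite /catalan_larcombe_french ratr_sum_frac; last first.
  by move=> j; rewrite ltnS => lejm; apply: coprime_bin.
rewrite !mulrA; apply: congr_modM; last exact: congr_mod_refl.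
set S := (X in congr_mod _ (X * _) _); set T := \sum_(0 <= j < _) _.
have -> : (-1) ^+ n * T / 16%:R ^+ m =
    ((-1) ^+ n * (-1) ^+ m * (T / 16%:R ^+ m)) * (-1) ^+ m.
  by rewrite [RHS]mulrC -!mulrA [in RHS]mulrCA signrMK.
apply: congr_modM; last exact: congr_mod_refl.
rewrite /T mulr_suml mulr_sumr; apply: congr_mod_sum => i; rewrite ltnS => leim.
have := @moment_congr p p_pr n i (m - i) Dp; rewrite subnKC // => /(_ ltmp).
rewrite natrM !natrX -mulnBr -[_ / _ / _]mulrA -invrM ?unitrX //; last first.
  by rewrite padic_natr_unit // coprime_bin.
by rewrite [16%:R ^+ m * _]mulrC.
Qed.
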